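(* Let $L:\mathbb{R}^n\to[0,\infty)$ be an everywhere finite convex function such that $L(0)=0$ and $L(x)>0$ for all $x\neq 0$, and let $(\Omega,\mathfrak{M},\lambda)$ be a probability space. For any measurable function $u:\Omega\to\mathbb{R}^n$, $$\|u\|_L\le |u|_L\le 2\,\|u\|_L .$$
   Context: The conjugate of $L$ is $L^*(x)=\sup_{y\in\mathbb{R}^n}[\langle x,y\rangle-L(y)]$, $x\in\mathbb{R}^n$, with values in $[0,\infty]$. For a measurable function $u:\Omega\to\mathbb{R}^n$, the Luxemburg pseudo-norm is $$\|u\|_L=\inf\Big\{r>0:\int L(u/r)\,d\lambda\le 1\Big\},$$ with $\|u\|_L=\infty$ if no such $r$ exists. For measurable $v:\Omega\to\mathbb{R}^n$, $\|v\|_{L^*}$ is defined by the same formula with $L^*$ in place of $L$. The Orlicz pseudo-norm of $u$ is, when $\|u\|_L<\infty$, $|u|_L=\sup\{\int\langle u,v\rangle\,d\lambda:\|v\|_{L^*}\le 1\}$, where the supremum is over measurable $v:\Omega\to\mathbb{R}^n$. Equivalently, $$|u|_L=\sup\Big\{\int\langle u,v\rangle^+\,d\lambda:\ \|v\|_{L^*}\le 1\Big\},\qquad a^+=\max(a,0),$$ and this second formula is taken as the definition of $|u|_L\in[0,\infty]$ for every measurable $u$ (without the restriction $\|u\|_L<\infty$). *)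

(* Defs.v *)
From HB Require Import structures.
From mathcomp Require Import all_boot all_order all_algebra.
From mathcomp Require Import all_classical all_reals all_analysis.

Set Implicit Arguments.
Unset Strict Implicit.
Unset Printing Implicit Defensive.

Import Order.TTheory GRing.Theory Num.Theory.
Import numFieldTopology.Exports numFieldNormedType.Exports.

Local Open Scope classical_set_scope.
Local Open Scope ring_scope.
Local Open Scope ereal_scope.

Section Defs.
Context {R : realType} {n : nat}.

Definition inner (x y : 'rV[R]_n) : R :=
  (\sum_(i < n) x ord0 i * y ord0 i)%R.

Definition conjugate (L : 'rV[R]_n -> R) (x : 'rV[R]_n) : \bar R :=
  ereal_sup [set (inner x y - L y)%:E | y in [set: 'rV[R]_n]].

Context {d : measure_display} {T : measurableType d}.

(* Measurability is with respect to the Borel sets of R^n, i.e. the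
   sigma-algebra generated by the open subsets of 'rV[R]_n. *)
Definition borel_measurable (u : T -> 'rV[R]_n) : Prop :=
  measurable_fun [set: T]
    (u : T -> g_sigma_algebraType (@open 'rV[R]_n)).

(* Phi takes extended real values so that the same definition serves for a
   finite function L (as EFin \o L) and for its conjugate.  The infimum of the
   empty set is +oo. *)
Definition luxemburg_norm (mu : {measure set T -> \bar R})
    (Phi : 'rV[R]_n -> \bar R) (u : T -> 'rV[R]_n) : \bar R :=
  ereal_inf [set r%:E | r in
    [set r : R | (0 < r)%R /\ \int[mu]_w Phi (r^-1 *: u w)%R <= 1]].

Definition orlicz_norm (mu : {measure set T -> \bar R})
    (L : 'rV[R]_n -> R) (u : T -> 'rV[R]_n) : \bar R :=
  ereal_sup [set \int[mu]_w (Num.max (inner (u w) (v w)) 0)%:E | v in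
    [set v : T -> 'rV[R]_n |
      borel_measurable v /\ luxemburg_norm mu (conjugate L) v <= 1]].

End Defs.

(* Main.v *)
(* Lower bound: the convex function [L] is a countable supremum of affine
   functions [<., p_k> - b_k], given by its subgradients at the rational points.
   Selecting at each [w] the best of the first [k] of them at [u(w)/r] yields
   a finite-valued measurable almost-maximizer [v] in Young's inequality
   [<u/r, v> <= L(u/r) + L^*(v)].  Testing the Orlicz norm with [v], rescaled to
   have norm at most [1], bounds the integral of the partial suprema by [1] as
   soon as [|u|_L <= r]; monotone convergence gives [\int L(u/r) <= 1].
   Upper bound: integrate Young's inequality. *)
Require Import Defs.
From HB Require Import structures.
From mathcomp Require Import all_boot all_order all_algebra.
From mathcomp Require Import all_classical all_reals all_analysis.
From mathcomp Require Import measurable_realfun.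
From mathcomp Require Import ring lra.
Set Implicit Arguments.
Unset Strict Implicit.
Unset Printing Implicit Defensive.

Import Order.TTheory GRing.Theory Num.Theory.
Import numFieldTopology.Exports numFieldNormedType.Exports.
Local Open Scope classical_set_scope.
Local Open Scope ring_scope.

(** * Convex functions on a vector space: upper bounds and linear minorants *)

Section convex.
Context {R : realType} {E : lmodType R}.
Implicit Types (f : E -> R) (x y h : E).

Lemma convex_function_le f (a b : R) x y : convex_function [set: E] f ->
  0 <= a -> 0 <= b -> a + b = 1 ->
  f (a *: x + b *: y) <= a * f x + b * f y.
Proof.
move=> cf a0 b0 ab1; have bE : b = 1 - a by rewrite -ab1 addrAC subrr add0r.
have a1 : a <= 1 by rewrite -ab1 lerDl.
by have := cf (Itv01 a0 a1) x y (in_setT _) (in_setT _); rewrite bE.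
Qed.

(** The point [x + t *: h] is a convex combination of [x] and one of [x + h], [x - h], with weight
    [|t|] on the latter; [M] adds both increments so as to serve either sign of [t]. *)
Lemma convex_le_line f x h : convex_function [set: E] f ->
  exists M : R, 0 <= M /\
    forall t : R, `|t| <= 1 -> f (x + t *: h) <= f x + `|t| * M.
Proof.
move=> cf.
exists (`|f (x + h) - f x| + `|f (x - h) - f x|); split; first exact: addr_ge0.
move=> t t1.
have -> : x + t *: h = `|t| *: (x + Num.sg t *: h) + (1 - `|t|) *: x.
  rewrite scalerDr scalerA [_ * Num.sg t]mulrC -numEsg scalerBl scale1r.
  by rewrite addrAC [`|t| *: x + _]addrC subrK.
apply: le_trans (convex_function_le _ _ cf _ _ _) _ => //; rewrite ?subr_ge0//.
  by rewrite addrC subrK.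
suff : f (x + Num.sg t *: h) - f x <=
    `|f (x + h) - f x| + `|f (x - h) - f x|.
  by move=> /(ler_wpM2l (normr_ge0 t)); rewrite mulrBr; lra.
have [t0|t0|->] := ltrgt0P t.
- by rewrite gtr0_sg// scale1r (le_trans (ler_norm _))// lerDl.
- by rewrite ltr0_sg// scaleN1r (le_trans (ler_norm _))// lerDr.
- by rewrite sgr0 scale0r addr0 subrr addr_ge0.
Qed.

(** Induction on [s]: the displaced point is the midpoint of a move along the first vector and a
    move along the others, both with doubled coefficients. *)
Lemma convex_usc_span {I : eqType} f x (e : I -> E) (s : seq I) (eps : R) :
  convex_function [set: E] f -> 0 < eps ->
  exists2 d : R, 0 < d & forall c : I -> R, (forall i, `|c i| <= d) ->
    f (x + \sum_(i <- s) c i *: e i) <= f x + eps.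
Proof.
move=> cf; elim: s eps => [|j s IH] eps eps0.
  by exists 1 => // c _; rewrite big_nil addr0 lerDl ltW.
have [d d0 Hd] := IH eps eps0.
have [M [M0 HM]] := convex_le_line x (e j) cf.
have M1 : 0 < M + 1 by lra.
have half : 2^-1 + 2^-1 = 1 :> R by lra.
(* The bounds serve, in order, the induction hypothesis, the condition [|t| <= 1] on the line, and
   [|2 * c j| * M <= eps]; [M + 1] avoids dividing by zero. *)
exists (Num.min (d / 2) (Num.min (1 / 2) (eps / (M + 1) / 2))).
  by rewrite !lt_min !divr_gt0.
move=> c cd; rewrite big_cons.
have -> : x + (c j *: e j + \sum_(i <- s) c i *: e i) =
    2^-1 *: (x + (2 * c j) *: e j) +
    2^-1 *: (x + \sum_(i <- s) (2 * c i) *: e i).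
  rewrite !scalerDr scalerA mulKf// scaler_sumr addrACA -scalerDl half.
  rewrite scale1r; congr (_ + (_ + _)); apply: eq_bigr => i _.
  by rewrite scalerA mulKf.
apply: le_trans (convex_function_le _ _ cf _ _ _) _ => //; rewrite ?invr_ge0//.
have {}cd i : [/\ `|2 * c i| <= d, `|2 * c i| <= 1 & `|2 * c i| <= eps / (M + 1)].
  by have := cd i; rewrite !le_min normrM normr_nat => /and3P[]; split; lra.
have := Hd (fun i => 2 * c i) (fun i => let: And3 a _ _ := cd i in a).
have [_ c1 ce] := cd j.
have := HM _ c1.
have : `|2 * c j| * M <= eps.
  apply: (@le_trans _ _ (eps / (M + 1) * (M + 1))).
    by apply: ler_pM => //; lra.
  by rewrite divfK// gt_eqF.
lra.
Qed.

(* The admissible slopes along a new direction [e] form an interval: by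
   convexity every slope to the left of the subspace is at most every slope to
   its right. *)
Lemma convex_minorant_slope f (V : E -> R -> Prop) (e : E) :
  convex_function [set: E] f ->
  V 0 0 ->
  (forall a b x y r s, V x r -> V y s -> V (a *: x + b *: y) (a * r + b * s)) ->
  (forall x r, V x r -> r <= f x) ->
  exists m : R, forall x r t, V x r -> r + t * m <= f (x + t *: e).
Proof.
move=> cf V0 Vlin Vf.
pose A := [set (q.2 - f (q.1 - s *: e)) / s |
  q in [set q : E * R | V q.1 q.2] & s in [set s : R | 0 < s]].
have hA y r t : V y r -> 0 < t -> ubound A ((f (y + t *: e) - r) / t).
  move=> Vy t0 _ [[x q] /= Vx [s /= s0 <-]].
  rewrite ler_pdivrMr// mulrAC ler_pdivlMr//.
  have st0 : 0 < s + t by rewrite addr_gt0.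
  (* These weights cancel the [e] components of [x - s *: e] and [y + t *: e], so that [Vf] applies
     to the combination. *)
  have [a0 b0] : 0 <= t / (s + t) /\ 0 <= s / (s + t).
    by split; rewrite ltW// divr_gt0.
  have ab1 : t / (s + t) + s / (s + t) = 1.
    by rewrite -mulrDl addrC divff// gt_eqF.
  have h2 := Vf _ _ (Vlin (t / (s + t)) (s / (s + t)) _ _ _ _ Vx Vy).
  have := convex_function_le (x - s *: e) (y + t *: e) cf a0 b0 ab1.
  rewrite !scalerDr scalerN addrACA !scalerA.
  rewrite [s / _ * t]mulrAC [t / _ * s]mulrAC [s * t]mulrC addNr addr0.
  move=> h1; have := le_trans h2 h1.
  rewrite !(mulrAC _ (_^-1)) -!mulrDl ler_pM2r ?invr_gt0//; lra.
have A0 : A !=set0.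
  by exists ((0 - f (0 - 1 *: e)) / 1), (0, 0) => //; exists 1 => /=.
have Aub y r t : V y r -> 0 < t -> sup A <= (f (y + t *: e) - r) / t.
  by move=> Vy t0; apply: ge_sup => //; exact: hA.
have Ahub : has_ubound A by exists ((f (0 + 1 *: e) - 0) / 1); exact: hA.
exists (sup A) => x r t Vx; have [t0|t0|->] := ltrgt0P t.
- by have := Aub x r t Vx t0; rewrite ler_pdivlMr// mulrC; lra.
- have : (r - f (x - (- t) *: e)) / (- t) <= sup A.
    apply: ub_le_sup => //; exists (x, r) => //; exists (- t) => //=.
    by rewrite oppr_gt0.
  rewrite ler_pdivrMr ?oppr_gt0// scaleNr opprK; lra.
- by rewrite mul0r scale0r !addr0; exact: Vf.
Qed.

(** Finite-dimensional Hahn-Banach: the linear form is extended one vector at a time. It enters the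
    slope lemma as a relation, which spares a proof that it is well defined on the span. *)
Lemma convex_minorant_span {I : eqType} f (e : I -> E) (s : seq I) :
  convex_function [set: E] f -> f 0 = 0 -> uniq s ->
  exists p : I -> R, forall c : I -> R,
    \sum_(i <- s) c i * p i <= f (\sum_(i <- s) c i *: e i).
Proof.
move=> cf f0; elim: s => [|j s IH] /=.
  by exists (fun=> 0) => c; rewrite !big_nil f0.
move=> /andP[js /IH[p Hp]].
have [|a b x y r q [c [-> ->]] [c' [-> ->]]|x r [c [-> ->]]|m Hm] :=
    @convex_minorant_slope f (fun x r => exists c : I -> R,
    x = \sum_(i <- s) c i *: e i /\ r = \sum_(i <- s) c i * p i) (e j) cf.
- exists (fun=> 0); split; rewrite big1// => i _; first by rewrite scale0r.
  by rewrite mul0r.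
- exists (fun i => a * c i + b * c' i).
  rewrite !scaler_sumr !mulr_sumr -!big_split.
  by split; apply: eq_bigr => i _ /=; rewrite ?scalerDl ?scalerA// mulrDl !mulrA.
- exact: Hp.
exists (fun i => if i == j then m else p i) => c.
rewrite !big_cons eqxx [c j * m + _]addrC [c j *: e j + _]addrC.
apply: Hm; exists c; split => //; apply: eq_big_seq => i si.
by case: eqVneq si js => // -> ->.
Qed.

End convex.

(* A pair [q] encodes the affine function [y |-> <y, q.1> - q.2]; it minorizes
   [L] exactly when [L^*(q.1) <= q.2]. *)
Definition affine {R : realType} {n : nat} (q : 'rV[R]_n * R)
    (y : 'rV[R]_n) : R :=
  inner y q.1 - q.2.

(** * Subgradients and countable families of affine minorants *)

Section affine_minorants.
Context {R : realType} {n : nat}.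
Implicit Types (L : 'rV[R]_n -> R) (x y p : 'rV[R]_n).

Lemma innerDl x y p : inner (x + y) p = inner x p + inner y p.
Proof. by rewrite -big_split; apply: eq_bigr => i _; rewrite mxE mulrDl. Qed.

Lemma innerZl a x p : inner (a *: x) p = a * inner x p.
Proof. by rewrite mulr_sumr; apply: eq_bigr => i _; rewrite mxE mulrA. Qed.

Lemma innerNl x p : inner (- x) p = - inner x p.
Proof. by rewrite -scaleN1r innerZl mulN1r. Qed.

Lemma innerC x p : inner x p = inner p x.
Proof. by apply: eq_bigr => i _; rewrite mulrC. Qed.

Lemma inner0l x : inner 0 x = 0.
Proof. by rewrite -(scale0r 0) innerZl mul0r. Qed.

Lemma convex_usc L x (eps : R) : convex_function [set: 'rV[R]_n] L -> 0 < eps ->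
  exists2 d : R, 0 < d & forall h : 'rV[R]_n, (forall i, `|h ord0 i| <= d) ->
    L (x + h) <= L x + eps.
Proof.
move=> cL eps0; have [d d0 Hd] := convex_usc_span x
  (fun i : 'I_n => delta_mx ord0 i : 'rV[R]_n) (index_enum 'I_n) cL eps0.
by exists d => // h /Hd; rewrite -row_sum_delta.
Qed.

(** After translating [x] to the origin, [p] collects the values of a linear minorant on the
    standard basis. *)
Lemma convex_subgradient L x : convex_function [set: 'rV[R]_n] L ->
  exists p, forall y, L x + inner (y - x) p <= L y.
Proof.
move=> cL; pose f y := L (x + y) - L x.
have cf : convex_function [set: 'rV[R]_n] f.
  move=> t y z _ _; rewrite /f convRE /conv /=.
  have t1 : t%:num + (1 - t%:num) = 1 by rewrite addrC subrK.
  have -> : x + (t%:num *: y + (1 - t%:num) *: z) =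
      t%:num *: (x + y) + (1 - t%:num) *: (x + z).
    by rewrite !scalerDr addrACA -scalerDl t1 scale1r.
  have := @convex_function_le _ _ L t%:num (1 - t%:num) (x + y) (x + z) cL.
  rewrite subr_ge0 => /(_ (ge0 _) (le1 _) t1).
  rewrite /unstable.onem; lra.
have f0 : f 0 = 0 by rewrite /f addr0 subrr.
have [p Hp] := convex_minorant_span
  (fun i : 'I_n => delta_mx ord0 i : 'rV[R]_n) cf f0 (index_enum_uniq _).
exists (\row_i p i) => y.
have := Hp (fun i => (y - x) ord0 i); rewrite -row_sum_delta /f subrKC.
rewrite /inner; under [in X in _ -> X]eq_bigr do rewrite [(\row_i p i) _ _]mxE.
lra.
Qed.

Lemma rat_row_dense y (d : R) : 0 < d ->
  exists q : 'rV[rat]_n, forall i, `|(map_mx ratr q - y) ord0 i| <= d.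
Proof.
move=> d0.
have /choice[q Hq] : forall i : 'I_n, exists q : rat, `|ratr q - y ord0 i| <= d.
  move=> i; have yd : y ord0 i - d < y ord0 i + d by lra.
  have [q] := rat_in_itvoo yd; rewrite in_itv/= => /andP[q1 q2]; exists q.
  rewrite ler_norml; lra.
by exists (\row_i q i) => i; rewrite !mxE.
Qed.

(* Subgradients at the rational points suffice: [p] being a subgradient at [x],
   testing it at [2 x - y] shows that the minorant is at least
   [2 L x - L (2 x - y)] at [y]; the latter tends to [L y] as [x] tends to [y]. *)
Lemma countable_affine_minorants L : convex_function [set: 'rV[R]_n] L ->
  exists pb : nat -> 'rV[R]_n * R,
    (forall k y, affine (pb k) y <= L y) /\
    (forall y (eps : R), 0 < eps -> exists k, L y - eps < affine (pb k) y).
Proof.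
move=> cL; have /choice[g Hg] := fun x => convex_subgradient x cL.
(* Codes of no rational vector give the point [0], whose subgradient is a minorant as well. *)
pose x k : 'rV[R]_n := oapp (map_mx ratr) 0 (unpickle k : option 'rV[rat]_n).
exists (fun k => (g (x k), inner (x k) (g (x k)) - L (x k))).
split => [k y|y eps eps0]; rewrite /affine /=.
  by have := Hg (x k) y; rewrite innerDl innerNl; lra.
have eps4 : 0 < eps / 4 by rewrite divr_gt0.
have [d d0 Hd] := convex_usc y cL eps4.
have d2 : 0 < d / 2 by rewrite divr_gt0.
have [q Hq] := rat_row_dense y d2.
exists (pickle q); rewrite /affine /x pickleK /=.
set z := map_mx ratr q in Hq *.
have h1 : L (y - (z - y)) <= L y + eps / 4.
  by apply: Hd => i; rewrite mxE normrN (le_trans (Hq i))//; lra.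
have h2 : L (y + 2 *: (z - y)) <= L y + eps / 4.
  by apply: Hd => i; rewrite mxE normrM ger0_norm//; have := Hq i; lra.
have := Hg z (y + 2 *: (z - y)).
have -> : y + 2 *: (z - y) - z = z - y.
  by rewrite scaler_nat mulr2n addrA subrKC addrAC subrr add0r.
(* The subgradient at [y], tested at the reflection of [z], gives [L z >= L y - eps / 4]; the total
   loss is [3 * eps / 4]. *)
have := Hg y z; have := Hg y (y - (z - y)).
rewrite [y - _ - y]addrAC subrr add0r innerNl.
rewrite [inner (z - y) (g z)]innerDl innerNl.
lra.
Qed.

End affine_minorants.

(** Starting from the zero function, a minorant of any [L >= 0], makes the selected value
    nonnegative. *)
Fixpoint best_affine {R : realType} {n : nat} (pb : nat -> 'rV[R]_n * R)
    (k : nat) (y : 'rV[R]_n) : 'rV[R]_n * R :=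
  if k is j.+1 then
    if affine (best_affine pb j y) y < affine (pb j) y then pb j
    else best_affine pb j y
  else (0, 0).

(** * Selection among finitely many affine minorants *)

Section best_affine.
Context {R : realType} {n : nat}.
Variables (L : 'rV[R]_n -> R) (pb : nat -> 'rV[R]_n * R).
Hypothesis L_ge0 : forall y, 0 <= L y.
Hypothesis pb_le : forall k y, affine (pb k) y <= L y.

Lemma affine0 (y : 'rV[R]_n) : affine (0, 0) y = 0.
Proof. by rewrite /affine /= innerC inner0l subr0. Qed.

Lemma best_affine_le k y z : affine (best_affine pb k y) z <= L z.
Proof. by elim: k => [|k IH] /=; [rewrite affine0|case: ifP]. Qed.

Lemma affine_best_nd y :
  nondecreasing_seq (fun k => affine (best_affine pb k y) y).
Proof. by apply/nondecreasing_seqP => k /=; case: ifPn => // /ltW. Qed.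

Lemma affine_best_ge0 k y : 0 <= affine (best_affine pb k y) y.
Proof. by rewrite -(affine0 y); exact: (affine_best_nd y (leq0n k)). Qed.

Lemma affine_best_ge k y : affine (pb k) y <= affine (best_affine pb k.+1 y) y.
Proof. by rewrite /=; case: ltP. Qed.

(** Only finitely many pairs can be selected; the bound later makes the integral of the second
    component finite. *)
Lemma best_affine_bounded k : exists C, forall y, (best_affine pb k y).2 <= C.
Proof.
elim: k => [|k [C HC]]; first by exists 0.
exists (Num.max C (pb k).2) => y /=.
by case: ifP => _; rewrite le_max ?lexx ?HC ?orbT.
Qed.

Lemma cvg_affine_best y :
  (forall eps : R, 0 < eps -> exists k, L y - eps < affine (pb k) y) ->
  (affine (best_affine pb k y) y)%:E @[k --> \oo] --> (L y)%:E.
Proof.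
move=> pb_dense; apply: cvg_EFin; first exact: nearW.
apply/cvgrPdist_lt => eps /pb_dense[k Hk]; near=> j.
rewrite ger0_norm ?subr_ge0 ?best_affine_le// ltrBlDr -ltrBlDl.
apply: (lt_le_trans Hk); apply: (le_trans (affine_best_ge k y)).
by apply: affine_best_nd; near: j; exact: nbhs_infty_ge.
Unshelve. all: by end_near. Qed.

End best_affine.

(** * Borel measurability *)

Section borel_measurable.
Context {R : realType} {n : nat} {d : measure_display} {T : measurableType d}.
Implicit Types u v : T -> 'rV[R]_n.

Lemma borel_measurable_open u (B : set 'rV[R]_n) :
  borel_measurable u -> open B -> measurable (u @^-1` B).
Proof.
move=> mu oB; rewrite -[X in measurable X]setTI.
by apply: mu => //; exact: sub_sigma_algebra.
Qed.

Lemma borel_measurable_continuous u (f : 'rV[R]_n -> R) :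
  borel_measurable u -> continuous f -> measurable_fun setT (f \o u).
Proof.
move=> mu /continuousP cf; apply: (measurability _ (RGenOpens.measurableE R)).
move=> _ [_ [a [b ->] <-]]; rewrite setTI comp_preimage.
by apply: borel_measurable_open => //; exact/cf/interval_open.
Qed.

Lemma borel_measurable_comp u (f : 'rV[R]_n -> 'rV[R]_n) :
  borel_measurable u -> continuous f -> borel_measurable (f \o u).
Proof.
move=> mu /continuousP cf; apply: (@measurability _ _ _
  (g_sigma_algebraType (@open 'rV[R]_n)) setT _ (@open 'rV[R]_n)) => //.
move=> _ [B oB <-]; rewrite setTI comp_preimage.
by apply: borel_measurable_open => //; exact: cf.
Qed.

Lemma borel_measurable_scale (a : R) u :
  borel_measurable u -> borel_measurable (fun w => a *: u w).
Proof.
move=> mu; apply: (@borel_measurable_comp u ( *:%R a)) => //.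
exact: scaler_continuous.
Qed.

Lemma measurable_inner u v : borel_measurable u -> borel_measurable v ->
  measurable_fun setT (fun w => inner (u w) (v w)).
Proof.
move=> mu mv; apply: measurable_sum => i; apply: measurable_funM.
  by apply: (@borel_measurable_continuous u (fun x => x ord0 i)) => //;
    exact: coord_continuous.
by apply: (@borel_measurable_continuous v (fun x => x ord0 i)) => //;
    exact: coord_continuous.
Qed.

Lemma continuous_innerl (p : 'rV[R]_n) : continuous (inner ^~ p).
Proof.
apply: continuous_big => [|i _]; first exact: add_continuous.
move=> x; apply: (@continuousM R _ (fun y : 'rV[R]_n => y ord0 i)).
  exact: coord_continuous.
exact: cst_continuous.
Qed.

Lemma continuous_affine (q : 'rV[R]_n * R) : continuous (affine q).
Proof.
move=> y; apply: (@continuousB _ _ _ (inner ^~ q.1) (fun=> q.2)).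
  exact: continuous_innerl.
exact: cst_continuous.
Qed.

(** Strict superlevel sets of the supremum are unions of open sets, so [Q] may be uncountable. This
    covers both [L] and its conjugate. *)
Lemma measurable_sup_affine u (Q : set ('rV[R]_n * R)) : borel_measurable u ->
  measurable_fun setT (fun w => ereal_sup [set (affine q (u w))%:E | q in Q]).
Proof.
move=> mu; apply: (measurability _ (ErealGenOInfty.measurableE R)).
move=> _ [_ [a ->] <-]; rewrite setTI preimage_itvoy.
rewrite [X in measurable X](_ : _ =
    u @^-1` (\bigcup_(q in Q) [set y | a < affine q y])).
  apply: borel_measurable_open => //; apply: bigcup_open => q _.
  apply: (@open_comp _ _ (affine q) [set t | a < t]); last exact: open_gt.
  by move=> y _; exact: continuous_affine.
apply/seteqP; split => [w /ereal_sup_gtP[_ [q Qq <-]]|w [q Qq aq]].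
  by rewrite lte_fin => aq; exists q.
by apply/ereal_sup_gtP; exists (affine q (u w))%:E => //; exists q.
Qed.

Lemma measurable_best_affine u (pb : nat -> 'rV[R]_n * R) k :
  borel_measurable u ->
  borel_measurable (fun w => (best_affine pb k (u w)).1) /\
  measurable_fun setT (fun w => (best_affine pb k (u w)).2).
Proof.
move=> mu; elim: k => [|k [IH1 IH2]] /=; first by split; exact: measurable_cst.
have mb : measurable_fun setT (fun w =>
    affine (best_affine pb k (u w)) (u w) < affine (pb k) (u w)).
  apply: measurable_fun_ltr; apply: measurable_funB => //.
    exact: measurable_inner.
  by apply: measurable_inner => //; exact: measurable_cst.
split.
  rewrite [X in borel_measurable X](_ : _ = fun w =>
    if affine (best_affine pb k (u w)) (u w) < affine (pb k) (u w)
    then (pb k).1 else (best_affine pb k (u w)).1).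
    by apply: measurable_fun_ifT => //; exact: measurable_cst.
  by apply/funext => w; case: ifP.
rewrite [X in measurable_fun _ X](_ : _ = fun w =>
  if affine (best_affine pb k (u w)) (u w) < affine (pb k) (u w)
  then (pb k).2 else (best_affine pb k (u w)).2).
  by apply: measurable_fun_ifT => //; exact: measurable_cst.
by apply/funext => w; case: ifP.
Qed.

End borel_measurable.

(** * The conjugate function and Young's inequality *)

Section conjugate.
Context {R : realType} {n : nat} {d : measure_display} {T : measurableType d}.
Implicit Types (L : 'rV[R]_n -> R) (u v : T -> 'rV[R]_n).

Lemma conjugate_le L p (b : R) :
  (forall y, affine (p, b) y <= L y) -> (conjugate L p <= b%:E)%E.
Proof.
move=> pb; apply: ge_ereal_sup => _ [y _ <-]; rewrite lee_fin.
by have := pb y; rewrite /affine /= innerC; lra.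
Qed.

Lemma fenchel_young L x y : ((inner x y)%:E <= (L x)%:E + conjugate L y)%E.
Proof.
rewrite -leeBlDl// -EFinB; apply: ereal_sup_ubound; exists x => //.
by rewrite innerC.
Qed.

Lemma conjugate_ge0 L y : L 0 = 0 -> (0 <= conjugate L y)%E.
Proof. by move=> L0; have := fenchel_young L 0 y; rewrite L0 add0e inner0l. Qed.

Lemma measurable_conjugate L v : borel_measurable v ->
  measurable_fun setT (conjugate L \o v).
Proof.
move=> mv; have := measurable_sup_affine [set (y, L y) | y in setT] mv.
congr measurable_fun; apply/funext => w; congr ereal_sup.
apply/seteqP; split => [_ [_ [y _ <-] <-]|_ [y _ <-]]; first by exists y.
by exists (y, L y) => //; exists y.
Qed.

(** A subgradient at each point shows that [L] is the supremum of its affine minorants. *)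
Lemma measurable_convex L u : convex_function [set: 'rV[R]_n] L ->
  borel_measurable u -> measurable_fun setT (EFin \o L \o u).
Proof.
move=> cL mu; have := measurable_sup_affine
  [set q | forall y, affine q y <= L y] mu.
congr measurable_fun; apply/funext => w; apply/eqP; rewrite eq_le.
apply/andP; split; first by apply: ge_ereal_sup => _ [q qL <-]; rewrite lee_fin.
have [p Hp] := convex_subgradient (u w) cL.
apply: ereal_sup_ubound; exists (p, inner (u w) p - L (u w)).
  by move=> y; have := Hp y; rewrite innerDl innerNl /affine /=; lra.
by rewrite /affine /=; congr EFin; lra.
Qed.

End conjugate.

(** * Comparison of the two norms *)

Section luxemburg_orlicz.
Context {R : realType} {n : nat} {d : measure_display} {T : measurableType d}.
Variables (P : probability T R) (L : 'rV[R]_n -> R).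
Hypothesis L_ge0 : forall x, 0 <= L x.
Hypothesis L_convex : convex_function [set: 'rV[R]_n] L.
Hypothesis L0 : L 0 = 0.
Implicit Types u v : T -> 'rV[R]_n.

Lemma orlicz_norm_le u (r : R) : borel_measurable u -> 0 < r ->
  (\int[P]_w (EFin \o L) (r^-1 *: u w)%R <= 1)%E ->
  (orlicz_norm P L u <= (2 * r)%:E)%E.
Proof.
move=> mu r0 ur1; apply: ge_ereal_sup => _ [v [mv v1] <-].
apply/lee_addgt0Pr => eps eps0.
(* The infimum need not be attained, so a radius [s] slightly above [1] is taken; the slack gives
   [2 * r * s <= 2 * r + eps]. *)
have : (luxemburg_norm P (conjugate L) v < (1 + eps / (2 * r))%:E)%E.
  by rewrite (le_lt_trans v1)// lte_fin ltrDl divr_gt0// mulr_gt0.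
move=> /ereal_inf_ltP[_ [s [s0 vs1] <-]]; rewrite lte_fin => s_lt.
have mL := measurable_convex L_convex (borel_measurable_scale r^-1 mu).
have mLc := measurable_conjugate L (borel_measurable_scale s^-1 mv).
have L_ge0' w : setT w -> (0 <= (EFin \o L) (r^-1 *: u w)%R)%E.
  by rewrite lee_fin.
have Lc_ge0 w : setT w -> (0 <= conjugate L (s^-1 *: v w)%R)%E.
  by move=> _; exact: conjugate_ge0.
(* Young's inequality at [u / r] and [v / s], multiplied by [r * s]; its right-hand side is
   nonnegative and hence also dominates the positive part. *)
apply: (@le_trans _ _ (\int[P]_w ((r * s)%:E *
    ((EFin \o L) (r^-1 *: u w)%R + conjugate L (s^-1 *: v w)%R)))%E).
  apply: ge0_le_integral => //.
  - by move=> w _; rewrite lee_fin le_max lexx orbT.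
  - apply/measurable_EFinP; apply: measurable_maxr => //.
    exact: measurable_inner.
  - by apply: measurable_funeM; exact: emeasurable_funD.
  - move=> w _; rewrite EFin_max ge_max; apply/andP; split; last first.
      apply: mule_ge0; first by rewrite lee_fin mulr_ge0// ltW.
      by rewrite adde_ge0 ?L_ge0' ?Lc_ge0.
    have := fenchel_young L (r^-1 *: u w) (s^-1 *: v w).
    rewrite innerZl innerC innerZl mulrA -invfM innerC EFinM.
    by rewrite lee_pdivrMl ?mulr_gt0.
rewrite ge0_integralZl//=; last 3 first.
- exact: emeasurable_funD.
- by move=> w _; rewrite adde_ge0 ?L_ge0' ?Lc_ge0.
- by rewrite lee_fin mulr_ge0// ltW.
rewrite ge0_integralD//.
apply: (@le_trans _ _ ((r * s)%:E * 2%:E)%E).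
  apply: lee_wpmul2l; first by rewrite lee_fin mulr_ge0// ltW.
  exact: (leeD ur1 vs1).
rewrite -EFinM -EFinD lee_fin.
have := ltW s_lt; rewrite -lerBlDl ler_pdivlMr ?mulr_gt0//; lra.
Qed.

(** The finite function [c] dominates [conjugate L \o v], so the radius [1] is admissible. *)
Lemma luxemburg_conjugate_le1 v (c : T -> R) :
  borel_measurable v -> measurable_fun setT c -> (forall w, 0 <= c w) ->
  (forall w y, affine (v w, c w) y <= L y) ->
  (\int[P]_w (c w)%:E <= 1)%E -> (luxemburg_norm P (conjugate L) v <= 1)%E.
Proof.
move=> mv mc c0 vc c1; apply: ereal_inf_lbound; exists 1 => //; split => //.
apply: le_trans c1; apply: ge0_le_integral => //.
- by move=> w _; exact: conjugate_ge0.
- exact: measurable_conjugate (borel_measurable_scale _ mv).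
- exact/measurable_EFinP.
- by move=> w _; rewrite invr1 scale1r; exact: conjugate_le.
Qed.

(** The zero function is an admissible competitor. *)
Lemma orlicz_norm_ge0 u : (0 <= orlicz_norm P L u)%E.
Proof.
apply: le_ereal_sup_tmp; exists (\int[P]_w (Num.max (inner (u w) 0) 0)%:E)%E.
  exists (fun=> 0) => //; split; first exact: measurable_cst.
  apply: (@luxemburg_conjugate_le1 _ (fun=> 0)) => //.
  - exact: measurable_cst.
  - by move=> w y; rewrite affine0.
  - by rewrite integral0.
by apply: integral_ge0 => w _; rewrite lee_fin le_max lexx orbT.
Qed.

(* With [m = <u/r, p> - b] and [s = max(1, \int b)], the function [p/s] is
   admissible in the Orlicz norm since [L^*(p/s) <= b/s]; hence
   [\int m + \int b = (1/r) \int <u, p> <= s], which forces [\int m <= 1]. *)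
Lemma integral_affine_le1 u (r C : R) (q : T -> 'rV[R]_n * R) :
  borel_measurable u -> 0 < r -> (orlicz_norm P L u <= r%:E)%E ->
  borel_measurable (fun w => (q w).1) -> measurable_fun setT (fun w => (q w).2) ->
  (forall w, (q w).2 <= C) -> (forall w y, affine (q w) y <= L y) ->
  (forall w, 0 <= affine (q w) (r^-1 *: u w)) ->
  (\int[P]_w (affine (q w) (r^-1 *: u w))%:E <= 1)%E.
Proof.
move=> mu r0 ur mq1 mq2 qC qL qu_ge0.
have q2_ge0 w : 0 <= (q w).2.
  by have := qL w 0; rewrite /affine inner0l L0; lra.
have mq2E : measurable_fun setT (fun w => ((q w).2)%:E) by exact/measurable_EFinP.
have [rho rho_ge0 rhoE] :
    exists2 rho, 0 <= rho & (\int[P]_w ((q w).2)%:E = rho%:E)%E.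
  have I_ge0 : (0 <= \int[P]_w ((q w).2)%:E)%E.
    by apply: integral_ge0 => w _; rewrite lee_fin.
  (* The bound [C] is integrable because [P] has total mass [1]. *)
  have I_fin : (\int[P]_w ((q w).2)%:E)%E \is a fin_num.
    rewrite ge0_fin_numE//.
    apply: (@le_lt_trans _ _ (\int[P]_w (cst C%:E w))%E).
      by apply: ge0_le_integral => // w _; rewrite lee_fin.
    by rewrite integral_cst// [X in (_ * X)%E](probability_setT P) mule1 ltry.
  exists (fine (\int[P]_w ((q w).2)%:E)%E); first exact: fine_ge0.
  by rewrite fineK.
(* Here [s >= rho] brings the integral of [(q w).2 / s] down to at most [1], and [s >= 1] with
   [L >= 0] keeps the rescaled affine functions below [L]. *)
pose s := Num.max 1 rho.
have s1 : 1 <= s by rewrite le_max lexx.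
have s0 : 0 < s by rewrite (lt_le_trans _ s1).
have rs0 : 0 < r / s by rewrite divr_gt0.
have ma : measurable_fun setT (fun w => affine (q w) (r^-1 *: u w)).
  apply: measurable_funB => //; apply: measurable_inner => //.
  exact: borel_measurable_scale.
have v1 : (luxemburg_norm P (conjugate L) (fun w => s^-1 *: (q w).1) <= 1)%E.
  apply: (@luxemburg_conjugate_le1 _ (fun w => s^-1 * (q w).2)).
  - exact: borel_measurable_scale.
  - exact: measurable_funM.
  - by move=> w; rewrite mulr_ge0// invr_ge0 ltW.
  - move=> w y; rewrite /affine /= innerC innerZl -mulrBr ler_pdivrMl//.
    rewrite innerC; apply: (le_trans (qL w y)).
    by rewrite -{1}[L y]mul1r ler_wpM2r.
  - under eq_integral do rewrite EFinM.
    rewrite ge0_integralZl//; last 2 first.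
      by move=> w _; rewrite lee_fin.
      by rewrite lee_fin invr_ge0 ltW.
    by rewrite rhoE -EFinM lee_fin ler_pdivrMl// mulr1 le_max lexx orbT.
have innerE w : (Num.max (inner (u w) (s^-1 *: (q w).1)) 0)%:E =
    ((r / s)%:E * ((affine (q w) (r^-1 *: u w))%:E + ((q w).2)%:E))%E.
  rewrite -EFinD -EFinM; congr EFin.
  have -> : inner (u w) (s^-1 *: (q w).1) =
      r / s * (affine (q w) (r^-1 *: u w) + (q w).2).
    rewrite /affine subrK innerC !innerZl innerC; field.
    by rewrite !gt_eqF.
  by apply/max_l/mulr_ge0; [exact: ltW|exact: addr_ge0].
have : (\int[P]_w (Num.max (inner (u w) (s^-1 *: (q w).1)) 0)%:E <= r%:E)%E.
  apply: le_trans ur; apply: ereal_sup_ubound.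
  exists (fun w => s^-1 *: (q w).1) => //; split => //.
  exact: borel_measurable_scale.
under eq_integral do rewrite innerE.
rewrite ge0_integralZl//=; last 3 first.
- by apply: emeasurable_funD => //; exact/measurable_EFinP.
- by move=> w _; rewrite adde_ge0// lee_fin.
- by rewrite lee_fin ltW.
rewrite ge0_integralD//; last 3 first.
- by move=> w _; rewrite lee_fin.
- exact/measurable_EFinP.
- by move=> w _; rewrite lee_fin.
rewrite rhoE.
(* A finite value [x] satisfies [x + rho <= s]: either [s = 1] and [x <= 1 - rho], or [s = rho] and
   [x <= 0]. The value [+oo] contradicts the bound by [r]. *)
case: (integral _ _ _) => [x| |]; last by rewrite leNye.
  rewrite -EFinD -EFinM !lee_fin -mulrA ger_pMr// ler_pdivrMl// mulr1 le_max.
  by case/orP; lra.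
by rewrite addye// gt0_muley ?lte_fin// leye_eq.
Qed.

Lemma luxemburg_norm_le u (r : R) : borel_measurable u -> 0 < r ->
  (orlicz_norm P L u <= r%:E)%E -> (luxemburg_norm P (EFin \o L) u <= r%:E)%E.
Proof.
move=> mu r0 ur; apply: ereal_inf_lbound; exists r => //; split => //.
have [pb [pb_le pb_dense]] := countable_affine_minorants L_convex.
have mU := borel_measurable_scale r^-1 mu.
pose m k w := (affine (best_affine pb k (r^-1 *: u w)) (r^-1 *: u w))%:E.
have m_ge0 k w : setT w -> (0 <= m k w)%E by rewrite lee_fin affine_best_ge0.
have m_nd w : setT w -> nondecreasing_seq (m ^~ w).
  by move=> _ i j ij; rewrite lee_fin; exact: affine_best_nd.
have mm k : measurable_fun setT (m k).
  have [m1 m2] := measurable_best_affine pb k mU.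
  apply/measurable_EFinP; apply: measurable_funB => //.
  exact: measurable_inner.
have -> : (\int[P]_w (EFin \o L) (r^-1 *: u w)%R = \int[P]_w limn (m ^~ w))%E.
  apply: eq_integral => w _; apply/esym/cvg_lim => //.
  exact: (cvg_affine_best L_ge0 pb_le (pb_dense _)).
rewrite monotone_convergence//; apply: lime_le.
  apply: ereal_nondecreasing_is_cvgn => i j ij; apply: ge0_le_integral => //.
  - by move=> w; exact: m_ge0.
  - by move=> w _; exact: m_nd.
apply: nearW => k; have [m1 m2] := measurable_best_affine pb k mU.
have [C HC] := best_affine_bounded pb k.
apply: (@integral_affine_le1 u r C _ mu r0 ur m1 m2) => // w.
- by move=> y; exact: best_affine_le.
- exact: affine_best_ge0.
Qed.

End luxemburg_orlicz.

Theorem proposition9p2 (R : realType) (n : nat) (L : 'rV[R]_n -> R)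
    (L_ge0 : forall x, 0 <= L x)
    (L_convex : convex_function [set: 'rV[R]_n] L)
    (L0 : L 0 = 0)
    (L_gt0 : forall x, x != 0 -> 0 < L x)
    (d : measure_display) (T : measurableType d) (P : probability T R)
    (u : T -> 'rV[R]_n) (u_meas : borel_measurable u) :
  (luxemburg_norm P (EFin \o L) u <= orlicz_norm P L u
     <= 2%:E * luxemburg_norm P (EFin \o L) u)%E.
Proof.
apply/andP; split.
  have := orlicz_norm_ge0 P L_ge0 L0 u.
  have := @luxemburg_norm_le _ _ _ _ P _ L_ge0 L_convex L0 u.
  case: (orlicz_norm P L u) => [c| |] lux_le; [|by move=> _; rewrite leey|by []].
  (* The Orlicz norm [c] may be [0], so the lower bound is applied at the positive radius
     [c + eps]. *)
  rewrite lee_fin => c0; apply/lee_addgt0Pr => eps eps0.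
  by apply: lux_le => //; rewrite ?lee_fin ?lerDl ?ltW// ltr_wpDl.
rewrite -lee_pdivrMl//; apply/ereal_infP => _ [r [r0 ur1] <-].
by rewrite lee_pdivrMl// -EFinM; exact: orlicz_norm_le.
Qed.
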